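(* Let $\mathcal{C}$ be an additive category which has cokernels and pseudo-kernels, and let $F$ and $G$ be functors in $\mathrm{mod}(\mathcal{C})$. Then there is a homomorphism $\theta_{F,G}:F(v(G))\to\mathrm{Hom}_{\mathrm{mod}(\mathcal{C})}(G,F)$ of abelian groups which is natural in $F$ and $G$. Moreover, if $F$ is in $\mathcal{D}$, then $\theta_{F,G}$ is monic.
   Context: $\mathcal{C}$ is a small category (relative to a fixed universe). $\mathrm{Mod}(\mathcal{C})$ is the category of additive functors $\mathcal{C}^{\mathrm{op}}\to\mathrm{Ab}$, where $\mathrm{Ab}$ is the category of abelian groups. A functor $F\in\mathrm{Mod}(\mathcal{C})$ is coherent if there is an exact sequence $\mathrm{Hom}_{\mathcal{C}}(-,A)\to\mathrm{Hom}_{\mathcal{C}}(-,B)\to F\to 0$ (a presentation of $F$) with $A,B\in\mathcal{C}$; $\mathrm{mod}(\mathcal{C})$ is the full subcategory of $\mathrm{Mod}(\mathcal{C})$ consisting of coherent functors. When $\mathcal{C}$ has cokernels, the Yoneda functor $h_{\mathcal{C}}:\mathcal{C}\to\mathrm{mod}(\mathcal{C})$, $A\mapsto\mathrm{Hom}_{\mathcal{C}}(-,A)$, has a left adjoint $v:\mathrm{mod}(\mathcal{C})\to\mathcal{C}$, given by $v(F)=\mathrm{Coker}(X\to Y)$ for a presentation $\mathrm{Hom}_{\mathcal{C}}(-,X)\to\mathrm{Hom}_{\mathcal{C}}(-,Y)\to F\to 0$, where $X\to Y$ is the morphism corresponding to the first map by the Yoneda lemma. A morphism $B\to A$ in $\mathcal{C}$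 is a pseudo-kernel of a morphism $A\to C$ if the induced sequence $\mathrm{Hom}_{\mathcal{C}}(-,B)\to\mathrm{Hom}_{\mathcal{C}}(-,A)\to\mathrm{Hom}_{\mathcal{C}}(-,C)$ is exact; $\mathcal{C}$ has pseudo-kernels if every morphism has one, and then $\mathrm{mod}(\mathcal{C})$ is abelian (Freyd). $\mathcal{D}$ is the full subcategory of $\mathrm{mod}(\mathcal{C})$ consisting of all functors which send epimorphisms of $\mathcal{C}$ to monomorphisms of abelian groups. *)

(* Defs.v *)
From HB Require Import structures.
From mathcomp Require Import all_boot all_algebra.
From mathcomp Require Import boolp.

Set Implicit Arguments.
Unset Strict Implicit.
Unset Printing Implicit Defensive.

Import GRing.Theory.
Local Open Scope ring_scope.

(* Abelian groups are [zmodType]s.  By classical choice every type is a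
   [choiceType], so this is no restriction.  Smallness of [C] is enforced by
   universe constraints: natural transformations between functors on [C] are
   again the carrier of a [zmodType]. *)

Record preadditive := Preadditive {
  obj :> Type;
  hom : obj -> obj -> zmodType;
  idm : forall A, hom A A;
  comp : forall A B D, hom B D -> hom A B -> hom A D;
  compA : forall A B D E (h : hom D E) (g : hom B D) (f : hom A B),
    comp h (comp g f) = comp (comp h g) f;
  comp1m : forall A B (f : hom A B), comp (idm B) f = f;
  compm1 : forall A B (f : hom A B), comp f (idm A) = f;
  compDl : forall A B D (g g' : hom B D) (f : hom A B),
    comp (g + g') f = comp g f + comp g' f;
  compDr : forall A B D (g : hom B D) (f f' : hom A B),
    comp g (f + f') = comp g f + comp g f'
}.
Arguments hom {p} A B : rename.
Arguments idm {p} A : rename.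
Arguments comp {p A B D} g f : rename.
Notation "g ∘ f" := (comp g f) (at level 40, left associativity).

Section CategoryNotions.
Variable C : preadditive.
Implicit Types A B X Y Z : C.

Definition is_zero_object Z :=
  (forall X (f g : hom Z X), f = g) /\ (forall X (f g : hom X Z), f = g).

Definition is_biproduct A B S (i1 : hom A S) (i2 : hom B S)
    (p1 : hom S A) (p2 : hom S B) :=
  [/\ p1 ∘ i1 = idm A, p2 ∘ i2 = idm B, p1 ∘ i2 = 0, p2 ∘ i1 = 0 &
      i1 ∘ p1 + i2 ∘ p2 = idm S].

Definition is_additive_category :=
  (exists Z, is_zero_object Z) /\
  (forall A B, exists S (i1 : hom A S) (i2 : hom B S)
     (p1 : hom S A) (p2 : hom S B), is_biproduct i1 i2 p1 p2).

Definition epi A B (f : hom A B) :=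
  forall X (g h : hom B X), g ∘ f = h ∘ f -> g = h.

Record cokernel A B (f : hom A B) := Cokernel {
  cok_obj : C;
  cok_map : hom B cok_obj;
  cok_zero : cok_map ∘ f = 0;
  cok_univ : forall X (g : hom B X), g ∘ f = 0 ->
    exists! h : hom cok_obj X, h ∘ cok_map = g
}.

Definition has_cokernels := forall A B (f : hom A B), inhabited (cokernel f).

Record add_functor := AddFunctor {
  fobj :> C -> zmodType;
  fmap : forall A B, hom A B -> {additive fobj B -> fobj A};
  fmap1 : forall A x, fmap (idm A) x = x;
  fmapM : forall A B D (g : hom B D) (f : hom A B) x,
    fmap (g ∘ f) x = fmap f (fmap g x);
  fmapD : forall A B (f g : hom A B) x, fmap (f + g) x = fmap f x + fmap g x
}.

Record nat_trans (F G : add_functor) := NatTrans {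
  napp :> forall X, {additive F X -> G X};
  nnat : forall A B (f : hom A B) x, napp A (fmap F f x) = fmap G f (napp B x)
}.

End CategoryNotions.
Arguments fmap {C} F {A B} f : rename.
Arguments napp {C F G} t X : rename.

Lemma additive_ext (U V : zmodType) (f g : {additive U -> V}) : f =1 g -> f = g.
Proof.
case: f g => [f [[fP]]] [g [[gP]]] /= /funext fg.
by case: _ / fg gP => gP; rewrite (Prop_irrelevance fP gP).
Qed.

Section NatTransGroup.
Variables (C : preadditive) (F G : add_functor C).

Lemma nat_trans_ext (s t : nat_trans F G) : (forall X, s X =1 t X) -> s = t.
Proof.
case: s t => [s sn] [t tn] /= st.
have {}st : s = t by apply: functional_extensionality_dep => X; exact/additive_ext/st.
by case: _ / st tn => tn; congr NatTrans.
Qed.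

HB.instance Definition _ := gen_eqMixin (nat_trans F G).
HB.instance Definition _ := gen_choiceMixin (nat_trans F G).

Fact nt0_nat A B (f : hom A B) (x : F B) :
  (\0 : {additive F A -> G A}) (fmap F f x) = fmap G f ((\0 : {additive F B -> G B}) x).
Proof. by rewrite /= raddf0. Qed.
Definition nt0 : nat_trans F G := NatTrans nt0_nat.

Fact ntN_nat (t : nat_trans F G) A B (f : hom A B) (x : F B) :
  (\- t A : {additive _ -> _}) (fmap F f x) =
  fmap G f ((\- t B : {additive _ -> _}) x).
Proof. by rewrite /= nnat raddfN. Qed.
Definition ntN t : nat_trans F G := NatTrans (ntN_nat t).

Fact ntD_nat (s t : nat_trans F G) A B (f : hom A B) (x : F B) :
  (s A \+ t A : {additive _ -> _}) (fmap F f x) =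
  fmap G f ((s B \+ t B : {additive _ -> _}) x).
Proof. by rewrite /= !nnat raddfD. Qed.
Definition ntD s t : nat_trans F G := NatTrans (ntD_nat s t).

Fact ntDA : associative ntD.
Proof. by move=> r s t; apply: nat_trans_ext => X x /=; rewrite addrA. Qed.
Fact ntDC : commutative ntD.
Proof. by move=> s t; apply: nat_trans_ext => X x /=; rewrite addrC. Qed.
Fact nt0D : left_id nt0 ntD.
Proof. by move=> s; apply: nat_trans_ext => X x /=; rewrite add0r. Qed.
Fact ntND : left_inverse nt0 ntN ntD.
Proof. by move=> s; apply: nat_trans_ext => X x /=; rewrite addNr. Qed.

HB.instance Definition _ := GRing.isZmodule.Build (nat_trans F G) ntDA ntDC nt0D ntND.

End NatTransGroup.

Section NatTransComp.
Variables (C : preadditive) (F G H : add_functor C).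
Variables (t : nat_trans G H) (s : nat_trans F G).
Fact nt_comp_nat A B (f : hom A B) (x : F B) :
  (t A \o s A : {additive _ -> _}) (fmap F f x) =
  fmap H f ((t B \o s B : {additive _ -> _}) x).
Proof. by rewrite /= !nnat. Qed.
Definition nt_comp : nat_trans F H := NatTrans nt_comp_nat.
End NatTransComp.

Section NatTransId.
Variables (C : preadditive) (F : add_functor C).
Fact nt_id_nat A B (f : hom A B) (x : F B) :
  (idfun : {additive F A -> F A}) (fmap F f x) =
  fmap F f ((idfun : {additive F B -> F B}) x).
Proof. by []. Qed.
Definition nt_id : nat_trans F F := NatTrans nt_id_nat.
End NatTransId.

Section Representable.
Variable C : preadditive.
Implicit Types A B X Y : C.

Lemma comp0m A B X (f : hom A B) : (0 : hom B X) ∘ f = 0.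
Proof. by apply: (addIr (0 ∘ f)); rewrite -compDl !add0r. Qed.
Lemma compm0 A B X (g : hom B X) : g ∘ (0 : hom A B) = 0.
Proof. by apply: (addIr (g ∘ 0)); rewrite -compDr !add0r. Qed.

Definition precomp A B X (f : hom A B) (g : hom B X) : hom A X := g ∘ f.
Definition postcomp A B X (g : hom B X) (f : hom A B) : hom A X := g ∘ f.

Fact precomp_additive A B X (f : hom A B) : nmod_morphism (@precomp A B X f).
Proof. by split=> [|g h]; [exact: comp0m|exact: compDl]. Qed.
HB.instance Definition _ A B X (f : hom A B) :=
  GRing.isNmodMorphism.Build (hom B X) (hom A X) (@precomp A B X f)
    (@precomp_additive A B X f).

Fact postcomp_additive A B X (g : hom B X) : nmod_morphism (@postcomp A B X g).
Proof. by split=> [|f h]; [exact: compm0|exact: compDr]. Qed.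
HB.instance Definition _ A B X (g : hom B X) :=
  GRing.isNmodMorphism.Build (hom A B) (hom A X) (@postcomp A B X g)
    (@postcomp_additive A B X g).

Definition yoneda X : add_functor C.
Proof.
refine (@AddFunctor C (fun A => hom A X)
  (fun A B f => (@precomp A B X f : {additive _ -> _})) _ _ _).
- by move=> A x; exact: compm1.
- by move=> A B D g f x; exact: compA.
- by move=> A B f g x; exact: compDr.
Defined.

Definition yoneda_map X Y (f : hom X Y) : nat_trans (yoneda X) (yoneda Y).
Proof.
refine (@NatTrans C (yoneda X) (yoneda Y)
  (fun A => (@postcomp A X Y f : {additive _ -> _})) _).
by move=> A B g x; exact: compA.
Defined.

Definition exact_at (U V W : zmodType) (f : U -> V) (g : V -> W) :=
  forall y, g y = 0 <-> exists x, f x = y.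

Definition surjective (U V : Type) (f : U -> V) := forall y, exists x, f x = y.

Definition is_pseudo_kernel A B D (k : hom B A) (f : hom A D) :=
  forall X, exact_at (yoneda_map k X) (yoneda_map f X).

Definition has_pseudo_kernels :=
  forall A D (f : hom A D), exists B (k : hom B A), is_pseudo_kernel k f.

Record presentation (F : add_functor C) := Presentation {
  pres_src : C;
  pres_tgt : C;
  pres_rel : nat_trans (yoneda pres_src) (yoneda pres_tgt);
  pres_gen : nat_trans (yoneda pres_tgt) F;
  pres_exact : forall X, exact_at (pres_rel X) (pres_gen X);
  pres_surj : forall X, surjective (pres_gen X)
}.

Definition pres_map F (P : presentation F) : hom (pres_src P) (pres_tgt P) :=
  pres_rel P _ (idm (pres_src P)).

(* The morphisms of mod(C), a full subcategory of Mod(C), are the natural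
   transformations between the underlying functors. *)
Record coherent := Coherent {
  cfun :> add_functor C;
  coherentP : inhabited (presentation cfun)
}.

Fact yoneda_coherent X : inhabited (presentation (yoneda X)).
Proof.
constructor; refine (@Presentation _ X X 0 (nt_id _) _ _) => Y.
- by move=> y; split=> [y0|[x] <-]//; exists 0; rewrite raddf0.
- by move=> y; exists y.
Qed.
Definition cyoneda X : coherent := Coherent (yoneda_coherent X).

Definition in_D (F : coherent) :=
  forall A B (f : hom A B), epi f -> injective (fmap F f).

End Representable.
Arguments pres_exact {C F} P X y : rename.
Arguments pres_surj {C F} P X y : rename.

(* The functor v : mod(C) -> C.  A presentation of each coherent functor and a
   cokernel of each morphism are picked by classical choice. *)

Lemma inhabited_ex (T : Type) : inhabited T -> exists _ : T, True.
Proof. by case=> x; exists x. Qed.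

Definition pick_inhabited (T : Type) (h : inhabited T) : T :=
  sval (cid (inhabited_ex h)).

Section LeftAdjoint.
Variable C : preadditive.
Hypothesis hcok : has_cokernels C.
Implicit Types F G H : coherent C.

Definition pres G : presentation G := pick_inhabited (coherentP G).

Definition vcok G : cokernel (pres_map (pres G)) :=
  pick_inhabited (hcok (pres_map (pres G))).

Definition vobj G : C := cok_obj (vcok G).

Lemma pres_relE (F : add_functor C) (P : presentation F) X
    (g : hom X (pres_src P)) : pres_rel P X g = pres_map P ∘ g.
Proof.
have := nnat (pres_rel P) g (idm _).
by rewrite /= /precomp comp1m.
Qed.

Lemma pres_lift (F H : add_functor C) (P : presentation F)
    (y : H (pres_tgt P)) : fmap H (pres_map P) y = 0 ->
  exists t : nat_trans F H, t _ (pres_gen P _ (idm _)) = y.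
Proof.
move=> y0.
pose lift X (x : F X) := sval (cid (pres_surj P X x)).
have liftK X x : pres_gen P X (lift X x) = x by rewrite /lift; case: cid.
pose t X (x : F X) : H X := fmap H (lift X x) y.
have tE X (g : hom X (pres_tgt P)) : t X (pres_gen P X g) = fmap H g y.
  have /pres_exact [z] : pres_gen P X (lift X (pres_gen P X g) - g) = 0.
    by rewrite raddfB liftK subrr.
  rewrite pres_relE => /esym/eqP; rewrite subr_eq => /eqP E.
  by rewrite /t E fmapD fmapM y0 raddf0 add0r.
have tD X : nmod_morphism (t X).
  split=> [|a b]; first by rewrite -(raddf0 (pres_gen P X)) tE;
    apply: (addIr (fmap H 0 y)); rewrite -fmapD !add0r.
  by rewrite -[a]liftK -[b]liftK -raddfD !tE fmapD.
pose tA X : {additive F X -> H X} :=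
  HB.pack (t X) (GRing.isNmodMorphism.Build _ _ (t X) (tD X)).
have tN A B (f : hom A B) x : tA A (fmap F f x) = fmap H f (tA B x).
  by rewrite /= -[x]liftK -nnat tE tE -fmapM.
by exists (NatTrans tN); rewrite /= tE fmap1.
Qed.

Lemma pres_lift_uniq (F H : add_functor C) (P : presentation F)
    (s t : nat_trans F H) :
  s _ (pres_gen P _ (idm _)) = t _ (pres_gen P _ (idm _)) -> s = t.
Proof.
move=> st; apply: nat_trans_ext => X x.
have [g <-] := pres_surj P X x.
have -> : g = fmap (yoneda _) g (idm _) by rewrite /= /precomp comp1m.
by rewrite !nnat st.
Qed.

(* The unit G -> Hom(-, v(G)): the factorisation through the presentation
   Hom(-, Y) -> G of the map induced by Y -> Coker(X -> Y). *)
Lemma vunit_ex G : exists t : nat_trans G (yoneda (vobj G)),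
  t _ (pres_gen (pres G) _ (idm _)) = cok_map (vcok G).
Proof. by apply: pres_lift; exact: cok_zero. Qed.

Definition vunit G : nat_trans G (cyoneda (vobj G)) := sval (cid (vunit_ex G)).

Lemma vunitE G : vunit G _ (pres_gen (pres G) _ (idm _)) = cok_map (vcok G).
Proof. exact: svalP (cid (vunit_ex G)). Qed.

Lemma vunit_univ G X (t : nat_trans G (cyoneda X)) :
  exists! f : hom (vobj G) X, nt_comp (yoneda_map f) (vunit G) = t.
Proof.
have [|f [fE fU]] := cok_univ (vcok G) (g := t _ (pres_gen (pres G) _ (idm _))).
  rewrite -[LHS]/(fmap (yoneda X) (pres_map (pres G)) _) -!nnat /= /precomp comp1m.
  by rewrite (proj2 (pres_exact (pres G) _ _)) ?raddf0//; exists (idm _).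
exists f; split=> [|g gE].
  by apply: (@pres_lift_uniq _ _ (pres G)); rewrite -fE -vunitE.
by apply: fU; rewrite -gE -vunitE.
Qed.

Definition vmap G H (b : nat_trans G H) : hom (vobj G) (vobj H) :=
  sval (cid (vunit_univ (nt_comp (vunit H) b))).

Lemma vmapE G H (b : nat_trans G H) :
  nt_comp (yoneda_map (vmap b)) (vunit G) = nt_comp (vunit H) b.
Proof. by rewrite /vmap; case: cid => f []. Qed.

Lemma vmap_uniq G H (b : nat_trans G H) f :
  nt_comp (yoneda_map f) (vunit G) = nt_comp (vunit H) b -> vmap b = f.
Proof. by rewrite /vmap; case: cid => g [gE gU] /= /gU. Qed.

Lemma vmap1 G : vmap (nt_id G) = idm (vobj G).
Proof. by apply: vmap_uniq; apply: nat_trans_ext => X x; exact: comp1m. Qed.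

Lemma vmapM G H K (b : nat_trans H (cfun K)) (a : nat_trans G H) :
  vmap (nt_comp b a) = vmap b ∘ vmap a.
Proof.
apply: vmap_uniq; apply: nat_trans_ext => X x.
have /(congr1 (fun t : nat_trans _ _ => t X x)) /= aE := vmapE a.
have /(congr1 (fun t : nat_trans _ _ => t X (a X x))) /= bE := vmapE b.
by rewrite /= -bE -aE /postcomp compA.
Qed.

End LeftAdjoint.

(* Main.v *)
Require Import Defs.
From HB Require Import structures.
From mathcomp Require Import all_boot all_algebra.
From mathcomp Require Import boolp.

Set Implicit Arguments.
Unset Strict Implicit.
Unset Printing Implicit Defensive.

Import GRing.Theory.
Local Open Scope ring_scope.

(** By the Yoneda lemma ([yoneda_elt]), an element [x] of [F (v G)] is a
    natural transformation from Hom(-, v G) to [F].  Precomposing it with the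
    unit of the adjunction, from [G] to Hom(-, v G), gives [theta x].
    Naturality in [F] is that of the Yoneda correspondence, and naturality in
    [G] is that of the unit ([vmapE]).

    For injectivity, let Hom(-, X) -> Hom(-, Y) -> G -> 0 be the chosen
    presentation.  The unit sends the generator of [G], the image of the
    identity of [Y], to the cokernel map [c : Y -> v G] ([vunitE]), so
    [theta x] sends this generator to [F(c)(x)].  As [c] is an epimorphism
    ([cok_map_epi]), [F(c)] is injective when [F] lies in D, and then [theta x]
    determines [x]. *)

Section YonedaElement.
Variable C : preadditive.
Implicit Types (F : add_functor C) (A : C).

Lemma fmap0 F A B (x : F B) : fmap F (0 : Defs.hom A B) x = 0.
Proof. by apply: (addIr (fmap F 0 x)); rewrite -fmapD !add0r. Qed.

Section Construction.
Variables (F : add_functor C) (A : C) (x : F A).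

Definition fmap_at X (f : yoneda A X) : F X := fmap F f x.

Fact fmap_at_additive X : nmod_morphism (@fmap_at X).
Proof. by split=> [|f g]; [exact: fmap0 | exact: fmapD]. Qed.
HB.instance Definition _ X :=
  GRing.isNmodMorphism.Build (yoneda A X) (F X) (@fmap_at X)
    (@fmap_at_additive X).

Fact fmap_at_nat X Y (f : Defs.hom X Y) (g : yoneda A Y) :
  (@fmap_at X : {additive _ -> _}) (fmap (yoneda A) f g) =
  fmap F f ((@fmap_at Y : {additive _ -> _}) g).
Proof. exact: fmapM. Qed.

Definition yoneda_elt : nat_trans (yoneda A) F := NatTrans fmap_at_nat.

End Construction.
End YonedaElement.

(** Both maps factor their common composite with the cokernel map, and such a
    factorisation is unique. *)
Lemma cok_map_epi (C : preadditive) (A B : C) (f : Defs.hom A B) (k : cokernel f) :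
  epi (cok_map k).
Proof.
move=> X g h gh.
have [|u [_ uU]] := cok_univ k (g := g ∘ cok_map k).
  by rewrite -Defs.compA cok_zero compm0.
by rewrite -(uU g erefl) -(uU h (esym gh)).
Qed.

Section Theta.
Variables (C : preadditive) (hcok : has_cokernels C).

Definition theta (F G : coherent C) (x : F (vobj hcok G)) : nat_trans G F :=
  nt_comp (yoneda_elt x) (vunit hcok G).

Fact theta_additive (F G : coherent C) : nmod_morphism (@theta F G).
Proof.
by split=> [|x y]; apply: nat_trans_ext => X g; [exact: raddf0 | exact: raddfD].
Qed.
HB.instance Definition _ (F G : coherent C) :=
  GRing.isNmodMorphism.Build (F (vobj hcok G)) (nat_trans G F) (@theta F G)
    (@theta_additive F G).

Lemma theta_natl (F F' G : coherent C) (a : nat_trans F F')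
    (x : F (vobj hcok G)) :
  theta (a (vobj hcok G) x) = nt_comp a (theta x).
Proof. by apply: nat_trans_ext => X g; exact/esym/nnat. Qed.

Lemma theta_natr (F G G' : coherent C) (b : nat_trans G G')
    (x : F (vobj hcok G')) :
  theta (fmap F (vmap hcok b) x) = nt_comp (theta x) b.
Proof.
apply: nat_trans_ext => X g.
have /(congr1 (fun t : nat_trans _ _ => t X g)) /= bE := vmapE hcok b.
by rewrite /= /fmap_at -bE -fmapM.
Qed.

(** A natural transformation out of [G] is determined by its value at the
    generator, so this formula reduces injectivity of [theta] to that of the
    map which [F] assigns to [cok_map]. *)
Lemma theta_gen (F G : coherent C) (x : F (vobj hcok G)) :
  theta x _ (pres_gen (pres G) _ (idm _)) = fmap F (cok_map (vcok hcok G)) x.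
Proof. by rewrite -vunitE. Qed.

Lemma theta_inj (F G : coherent C) : in_D F -> injective (@theta F G).
Proof.
move=> FD x y xy; apply: (FD _ _ _ (@cok_map_epi _ _ _ _ (vcok hcok G))).
by rewrite -!theta_gen xy.
Qed.

End Theta.

Theorem theorem4p4 (C : preadditive) (hC : is_additive_category C)
    (hcok : has_cokernels C) (hpk : has_pseudo_kernels C) :
  exists theta : forall F G : coherent C,
      {additive F (vobj hcok G) -> nat_trans G F},
    [/\ (forall (F F' G : coherent C) (a : nat_trans F F')
           (x : F (vobj hcok G)),
           theta F' G (a (vobj hcok G) x) = nt_comp a (theta F G x)),
        (forall (F G G' : coherent C) (b : nat_trans G G')
           (x : F (vobj hcok G')),
           theta F G (fmap F (vmap hcok b) x) = nt_comp (theta F G' x) b) &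
        (forall F G : coherent C, in_D F -> injective (theta F G))].
Proof.
exists (fun F G => (@theta C hcok F G : {additive _ -> _})).
by split; [exact: theta_natl | exact: theta_natr | exact: theta_inj].
Qed.
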